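(* Let $n\geq 3$. A permutation group $G\leq\mathcal{S}_n$ has the $2$-universal transversal property if and only if $G$ is primitive.
   Context: $\mathcal{S}_n$ is the symmetric group on $[n]=\{1,\ldots,n\}$. A section for a partition is a set containing exactly one point from each block. $G\leq\mathcal{S}_n$ has the $2$-universal transversal property if for every $2$-subset $I\subseteq[n]$ and every partition $P$ of $[n]$ into $2$ nonempty blocks there is $g\in G$ such that $Ig$ is a section for $P$. Primitive means transitive and preserving no nontrivial partition of $[n]$. *)

(* Defs.v *)
From mathcomp Require Import all_boot all_fingroup all_solvable.

Set Implicit Arguments.
Unset Strict Implicit.
Unset Printing Implicit Defensive.

(* [n] = {1, ..., n} is represented by 'I_n = {0, ..., n - 1}.  In MathComp,
   [is_transversal X P D] says that P is a partition of D (into nonempty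
   blocks) and that X is a subset of D meeting every block of P in exactly one
   point, i.e. that X is a section for P. *)
Definition universal_transversal (k n : nat) (G : {group 'S_n}) : Prop :=
  forall (I : {set 'I_n}) (P : {set {set 'I_n}}),
    #|I| = k -> partition P [set: 'I_n] -> #|P| = k ->
    exists2 g : 'S_n, g \in G & is_transversal (g @: I) P [set: 'I_n].
Arguments universal_transversal k {n} G.

(* Main.v *)
Require Import Defs.
From mathcomp Require Import all_boot all_fingroup all_solvable.

Set Implicit Arguments.
Unset Strict Implicit.
Unset Printing Implicit Defensive.

(** For k = 2, universal transversality says that every pair of distinct points
    is separated by some translate of every proper nonempty set A.  Orbits and
    blocks of imprimitivity are sets A whose translates fail to separate some
    pair; conversely, for a fixed A, "not separated by any translate of A" is a
    G-invariant equivalence relation, which is trivial when G is primitive. *)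

Section Separation.

Variable T : finType.
Implicit Types (A B : {set T}) (G : {group {perm T}}).

Definition separating G :=
  forall (x y : T) A, x != y -> A != set0 -> A != setT ->
    exists2 g : {perm T}, g \in G & (g x \in A) != (g y \in A).

Lemma partition_setC A :
  A != set0 -> A != setT -> partition [set A; ~: A] [set: T].
Proof.
move=> A0 AT; have nAC : A != ~: A.
  have [x Ax] := set0Pn _ A0.
  by apply/eqP => /setP/(_ x); rewrite inE Ax.
apply/and3P; split; last 1 first.
- rewrite !inE negb_or eq_sym A0 /= eq_sym.
  by apply: contra AT => /eqP/(congr1 (@setC T)); rewrite setCK setC0 => ->.
- by rewrite /cover bigcup_setU !big_set1 setUCr.
(* [trivIset] is by definition an equality between the sum of the block sizes and the size of the
   cover, so disjointness reduces to [cardsC]. *)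
rewrite /trivIset /cover bigcup_setU !big_set1 setUCr cardsT -(cardsC A).
by rewrite big_setU1 ?big_set1 // inE.
Qed.

Lemma partition_set2 A B : A != B -> partition [set A; B] [set: T] ->
  [/\ B = ~: A, A != set0 & A != setT].
Proof.
move=> nAB /and3P[/eqP]; rewrite /cover bigcup_setU !big_set1 => covAB.
move=> /trivIsetP/(_ _ _ (set21 _ _) (set22 _ _) nAB) disjAB.
rewrite !inE negb_or => /andP[A0 B0].
have defB : B = ~: A.
  apply/eqP; rewrite eqEsubset -disjoints_subset disjoint_sym disjAB /=.
  by apply/subsetP=> x; have := in_setT x; rewrite -covAB !inE; case: (x \in A).
split=> //; first by rewrite eq_sym.
by apply: contraNneq B0 => AT; rewrite defB AT setCT.
Qed.

(** Two distinct points with exactly one in [A] automatically have exactly one in [~: A], so a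
    single block decides. *)
Lemma is_transversal_setC (x y : T) A : x != y -> A != set0 -> A != setT ->
  is_transversal [set x; y] [set A; ~: A] [set: T]
    = ((x \in A) != (y \in A)).
Proof.
move=> nxy A0 AT; rewrite /is_transversal partition_setC // subsetT /=.
have cardI B : #|[set x; y] :&: B| = (x \in B) + (y \in B).
  rewrite -sum1_card big_mkcond /= (bigD1 x) //= (bigD1 y) 1?eq_sym //=.
  rewrite big1 => [|z /andP[/negbTE zx /negbTE zy]]; last first.
    by rewrite !inE zx zy.
  by rewrite !inE !eqxx orbT addn0; do 2!case: (_ \in B).
apply/forall_inP/idP => [/(_ A (set21 _ _))|sepA B].
  by rewrite cardI; do 2!case: (_ \in A).
by case/set2P=> ->; rewrite cardI ?inE; move: sepA; do 2!case: (_ \in A).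
Qed.

(** No element of [G] moves a point across the boundary of an orbit, so a proper orbit [O] could
    only separate pairs that it already splits. All pairs would then be split by [O], which leaves
    room for at most two points. The bound is sharp: the trivial group on two points is
    separating. *)
Lemma separating_trans G : 2 < #|T| -> separating G ->
  [transitive G, on [set: T] | 'P].
Proof.
move=> T_gt2 sepG; have [x _] := card_gt0P (ltnW (ltnW T_gt2)).
apply/imsetP; exists x; rewrite ?inE //; apply/eqP; rewrite eq_sym.
apply/negPn/negP => nOT; set O := orbit _ _ _ in nOT.
have O0 : O != set0 by apply/set0Pn; exists x; apply: orbit_refl.
have actO g z : g \in G -> (g z \in O) = (z \in O).
  by move=> Gg; rewrite -[g z]apermE (orbit_actr 'P).
have same_side y z : (y \in O) = (z \in O) -> y = z.
  move=> yz; apply/eqP; apply: contraT => nyz.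
  by have [g Gg] := sepG y z O nyz O0 nOT; rewrite !actO // yz eqxx.
have injO : injective (fun y : T => y \in O) by move=> y z /same_side.
by have := leq_card _ injO; rewrite card_bool leqNgt T_gt2.
Qed.

Lemma separating_primitive G : 2 < #|T| -> separating G ->
  [primitive G, on [set: T] | 'P].
Proof.
move=> T_gt2 sepG; apply/andP; split; first exact: separating_trans.
apply/existsP=> -[Q /and3P[partQ actQ /andP[Q_gt1 Q_lt]]].
have [/eqP covQ tiQ Q0] := and3P partQ.
have inQ x : x \in cover Q by rewrite covQ inE.
(* Having fewer blocks than points forces two distinct points into one block. *)
have [/injectiveP injQ | /injectivePn[x [y nxy exy]]] :=
    boolP (injectiveb (pblock Q)).
  have : #|pblock Q @: [set: T]| <= #|Q|.
    by apply/subset_leq_card/subsetP=> _ /imsetP[x _ ->]; apply: pblock_mem.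
  by rewrite card_imset // leqNgt Q_lt.
pose B := pblock Q x.
have QB : B \in Q by apply: pblock_mem.
have B0 : B != set0 by apply: contraNneq Q0 => <-.
have BT : B != setT.
  have [C] : exists2 C, C \in Q & C != B.
    apply/exists_inP; apply: contraLR Q_gt1 => /exists_inPn eqB.
    rewrite -leqNgt -(cards1 B); apply/subset_leq_card.
    by apply/subsetP=> C /eqB; rewrite negbK inE.
  move=> QC nCB; apply: contraNneq Q0 => defB.
  have := trivIsetP tiQ _ _ QC QB nCB.
  by rewrite defB -setI_eq0 setIT => /eqP <-.
have [g Gg] := sepG x y B nxy B0 BT.
have QgB : g @: B \in Q.
  by have := actsP actQ g Gg B; rewrite QB /= /setact.
have gBx : g x \in g @: B by rewrite imset_f ?mem_pblock.
have gBy : g y \in g @: B by rewrite imset_f // /B exy mem_pblock.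
(* The blocks [g @: B] and [B] coincide or are disjoint, so the answer does not depend on the point
   [z] of [B], and [x], [y] stay on the same side. *)
have sideE z : g z \in g @: B -> (g z \in B) = (g @: B == B).
  move=> gBz; apply/idP/eqP=> [Bz | <- //].
  by rewrite -(def_pblock tiQ QgB gBz) (def_pblock tiQ QB Bz).
by rewrite !sideE ?eqxx.
Qed.

Lemma primitive_separating G :
  [primitive G, on [set: T] | 'P] -> separating G.
Proof.
case/andP=> _ /existsP primG x y A nxy A0 AT.
apply/exists_inP; apply: contraT => /exists_inPn unsep; case: primG.
(* Two points have the same image under [f] exactly when no element of [G] separates them by [A];
   the fibres of [f] will form the imprimitivity system. *)
pose f (z : T) := [set g in G | (g : {perm T}) z \in A].
have fE (u v : T) : (f u == f v) = [forall g in G, (g u \in A) == (g v \in A)].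
  apply/eqP/forall_inP => [/setP fuv g Gg | fuv].
    by have := fuv g; rewrite !inE Gg /= => ->.
  by apply/setP=> g; rewrite !inE; case: (boolP (g \in G)) => // /fuv/eqP.
have f_act g u v : g \in G -> f u = f v -> f (g u) = f (g v).
  move=> Gg /eqP; rewrite fE => /forall_inP fuv; apply/eqP; rewrite fE.
  (* Products act from left to right: [h (g u)] is [(g * h) u], and [g * h] is again in [G]. *)
  by apply/forall_inP=> h Gh; rewrite -!permM; apply/fuv/groupM.
pose Q := preim_partition f [set: T].
have partQ : partition Q [set: T] := preim_partitionP _ _.
have [/eqP covQ tiQ Q0] := and3P partQ.
have QE u : pblock Q u = [set v | f u == f v].
  apply/setP=> v; rewrite inE pblock_equivalence_partition ?inE //.
  by split=> // /eqP ->.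
have QP B : reflect (exists u, B = [set v | f u == f v]) (B \in Q).
  apply: (iffP idP) => [QB | [u ->]]; last first.
    by rewrite -QE pblock_mem // covQ inE.
  have [u Bu] : exists u, u \in B by apply/set0Pn; apply: contraNneq Q0 => <-.
  by exists u; rewrite -QE (def_pblock tiQ QB).
exists Q; apply/and3P; split=> //.
  (* One implication suffices, since its converse is the same statement for the inverse of [g]. The
     image under [h] of the fibre through [u] is the fibre through [h u]. *)
  apply/actsP=> g Gg; suff actB h B : h \in G -> B \in Q -> 'P^*%act B h \in Q.
    move=> B; apply/idP/idP => [QgB|]; last exact: actB.
    by rewrite -(actK 'P^* g B); apply: actB; rewrite ?groupV.
  move=> Gh /QP[u ->]; apply/QP; exists (h u).
  apply/setP=> v; apply/imsetP/idP=> [[w] | ].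
    by rewrite !inE => /eqP fuw -> /=; rewrite apermE; apply/eqP/f_act.
  rewrite inE => /eqP fhv; exists (h^-1%g v); last by rewrite /= apermE permKV.
  by rewrite inE -{1}(permK h u); apply/eqP/f_act; rewrite ?groupV.
apply/andP; split.
  (* The identity already separates a point of [A] from a point outside, which gives two blocks. *)
  have [a Aa] := set0Pn _ A0.
  have [b] : exists b, b \in ~: A.
    apply/set0Pn; apply: contraNneq AT => AC0.
    by rewrite -(setCK A) AC0 setC0.
  rewrite inE => nAb; have nfab : ~~ (f a == f b).
    rewrite fE; apply/forall_inP=> /(_ 1%g (group1 G)).
    by rewrite !perm1 Aa (negbTE nAb).
  have nQab : pblock Q a != pblock Q b.
    by rewrite eq_pblock // ?covQ ?inE // QE inE.
  have <- : #|[set pblock Q a; pblock Q b]| = 2 by rewrite cards2 nQab.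
  by apply/subset_leq_card/subsetP=> B /set2P[]->;
    rewrite pblock_mem ?covQ ?inE.
have Qxy : pblock Q x = pblock Q y.
  apply/eqP; rewrite eq_pblock // ?covQ ?inE // QE inE fE.
  by apply/forall_inP=> g /unsep; rewrite negbK.
(* As [x] shares its block with [y], the points other than [x] reach every block, so there are fewer
   blocks than points. *)
have -> : Q = pblock Q @: [set~ x].
  apply/setP=> B; apply/QP/imsetP=> [[u ->] | [u _ ->]]; last by exists u.
  have [-> | nux] := eqVneq u x; last by exists u; rewrite ?QE // !inE.
  by exists y; rewrite -?Qxy ?QE // !inE eq_sym.
apply: (leq_ltn_trans (leq_imset_card _ _)).
apply/proper_card/properP; split; first exact: subsetT.
by exists x; rewrite !inE ?eqxx.
Qed.

End Separation.

Lemma universal_transversal2P (n : nat) (G : {group 'S_n}) :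
  universal_transversal 2 G <-> separating G.
Proof.
have imset2 (g : 'S_n) x y : g @: [set x; y] = [set g x; g y].
  by rewrite imsetU1 imset_set1.
split=> [utG x y A nxy A0 AT | sepG I P].
  have nAC : #|[set A; ~: A]| = 2.
    rewrite cards2; case: eqVneq => // AC.
    have [z Az] := set0Pn _ A0.
    by have /setP/(_ z) := AC; rewrite inE Az.
  have [|g Gg] := utG [set x; y] [set A; ~: A] _ (partition_setC A0 AT) nAC.
    by rewrite cards2 nxy.
  rewrite imset2 is_transversal_setC ?(inj_eq perm_inj) // => sepA.
  by exists g.
move=> /eqP/cards2P[x [y [nxy ->]]] partP /eqP/cards2P[A [B [nAB defP]]].
move: partP; rewrite defP => /(partition_set2 nAB)[-> A0 AT].
have [g Gg sepA] := sepG x y A nxy A0 AT.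
by exists g; rewrite // imset2 is_transversal_setC ?(inj_eq perm_inj).
Qed.

Theorem theorem1p8 (n : nat) (G : {group 'S_n}) (hn : 3 <= n) :
  universal_transversal 2 G <-> [primitive G, on [set: 'I_n] | 'P].
Proof.
split=> [/universal_transversal2P | primG].
  by apply: separating_primitive; rewrite card_ord.
exact/universal_transversal2P/primitive_separating.
Qed.
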